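(* Let $p$ be a prime, $m,n\ge 2$ integers and $a,b,c,d,e,f,g,h\in\mathbb{Z}_p$. Let $T_{\mathrm R}^{\phi}\in \mathbf{M}_{mn\times mn}(\mathbb{Z}_p)$ be the rule matrix of the finite two-dimensional linear Moore cellular automaton on an $m\times n$ grid with coefficients $a,\dots,h$ under the mixed boundary condition $\phi$ (null on the top and left, reflexive on the bottom and right). Then $T_{\mathrm R}^{\phi}$ is the $m\times m$ block matrix with $n\times n$ blocks $$T_{\mathrm R}^{\phi}=\begin{pmatrix} A_1 & B_1 & O & O &\dots & O & O & O\\ C_1 & A_1 & B_1 & O & \dots & O & O & O\\ O & C_1 & A_1 & B_1 &\dots & O & O & O\\ \vdots & \vdots & \vdots & \vdots &\ddots &\vdots & \vdots & \vdots\\ O & O & O & O & \dots & C_1 & A_1 & B_1\\ O & O & O & O & \dots & O & D_1 & A_1 \end{pmatrix},$$ where $A_1=A+d\,\epsilon_{n,n-1}$, $B_1=B+e\,\epsilon_{n,n-1}$, $C_1=C+c\,\epsilon_{n,n-1}$ and $D_1=B+C+(c+e)\,\epsilon_{n,n-1}+g\,\epsilon_{1,2}$.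
   Context: Cellular automaton. A configuration is a matrix $(x_{i,j})_{1\le i\le m,\,1\le j\le n}$ over the field $\mathbb{Z}_p$. One time step replaces every $x_{i,j}$ simultaneously by $$a x_{i-1,j-1}+b x_{i-1,j}+c x_{i-1,j+1}+d x_{i,j+1}+e x_{i+1,j+1}+f x_{i+1,j}+g x_{i+1,j-1}+h x_{i,j-1}\pmod p,$$ where values at cells outside the grid (row index $0$ or $m+1$, or column index $0$ or $n+1$) are prescribed by the boundary condition. Boundary condition $\phi$: $x_{0,l}=0$ for $0\le l\le n+1$; $x_{k,0}=0$ for $0\le k\le m$; $x_{k,n+1}=x_{k,n-1}$ for $1\le k\le m$; $x_{m+1,l}=x_{m-1,l}$ for $1\le l\le n$; $x_{m+1,0}=x_{m-1,2}$ if this refers to a grid cell (it does since $n\ge2$); $x_{m+1,n+1}=x_{m-1,n-1}$. Rule matrix. Identify a configuration with the column vector $X=(x_{11},\dots,x_{1n},\dots,x_{m1},\dots,x_{mn})^T\in\mathbb{Z}_p^{mn}$. The rule matrix is the matrix $T$ such that $X^{(t+1)}=T X^{(t)}$ for every configuration $X^{(t)}$ with successor $X^{(t+1)}$. Notation. All blocks are $n\times n$ over $\mathbb{Z}_p$. $P$ has ones on the first superdiagonal and zeros elsewhere; $Q=P^T$ has ones on the first subdiagonal; $I$ is the identity; $O$ is the zero matrix; $\epsilon_{k,l}$ is the matrix unit with a single $1$ in position $(k,l)$. $A=dP+hQ$, $B=fI+eP+gQ$, $C=bI+cP+aQ$. In the block matrix all diagonal blocks are $A_1$, all superdiagonal blocks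 are $B_1$, and all subdiagonal blocks are $C_1$ except the last one, in block position $(m,m-1)$, which is $D_1$; all other blocks are $O$. *)

(* Defs.v *)
From mathcomp Require Import all_boot all_order all_algebra.

Set Implicit Arguments.
Unset Strict Implicit.
Unset Printing Implicit Defensive.

Import GRing.Theory.
Local Open Scope ring_scope.

(* Grid cells are written with 1-based indices k, l : nat, as x_{k,l}; an      *)
(* ordinal i : 'I_m stands for the row i.+1. [cell] is meant for k, l >= 1.    *)
Definition cell (R : comNzRingType) (m n : nat) (X : 'M[R]_(m, n)) (k l : nat) : R :=
  if (insub k.-1, insub l.-1) is (Some i, Some j) then X i j else 0.

(* The configuration extended to 0 <= k <= m + 1, 0 <= l <= n + 1 by the       *)
(* boundary condition phi: null on the top and left, reflexive on the bottom   *)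
(* and right; the corner (m + 1, 0) reflects to (m - 1, 2).                    *)
Definition phi_ext (R : comNzRingType) (m n : nat) (X : 'M[R]_(m, n)) (k l : nat) : R :=
  if k == 0%N then 0
  else if (k <= m)%N then
    if l == 0%N then 0
    else if l == n.+1 then cell X k n.-1
    else cell X k l
  else
    if l == 0%N then cell X m.-1 2
    else if l == n.+1 then cell X m.-1 n.-1
    else cell X m.-1 l.

(* The cell (i.+1, j.+1) has upper-left neighbour (i, j) and lower-right       *)
(* neighbour (i.+2, j.+2).                                                     *)
Definition phi_step (R : comNzRingType) (m n : nat) (a b c d e f g h : R)
    (X : 'M[R]_(m, n)) : 'M[R]_(m, n) :=
  let x := phi_ext X in
  \matrix_(i < m, j < n)
    (a * x i j + b * x i j.+1 + c * x i j.+2 + d * x i.+1 j.+2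
     + e * x i.+2 j.+2 + f * x i.+2 j.+1 + g * x i.+2 j + h * x i.+1 j).

(* [mxvec] lists the entries row by row. *)
Definition config_vec (R : comNzRingType) (m n : nat) (X : 'M[R]_(m, n)) : 'cV[R]_(m * n) :=
  (mxvec X)^T.

Definition is_phi_rule_matrix (R : comNzRingType) (m n : nat) (a b c d e f g h : R)
    (T : 'M[R]_(m * n)) : Prop :=
  forall X : 'M[R]_(m, n),
    config_vec (phi_step a b c d e f g h X) = T *m config_vec X.

Definition Pmx (R : comNzRingType) (n : nat) : 'M[R]_n :=
  \matrix_(i, j) (j == i.+1 :> nat)%:R.

Definition Qmx (R : comNzRingType) (n : nat) : 'M[R]_n := (Pmx R n)^T.

(* Matrix unit at the 1-based position (k, l). *)
Definition epsmx (R : comNzRingType) (n k l : nat) : 'M[R]_n :=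
  \matrix_(i, j) ((i.+1 == k) && (j.+1 == l))%:R.

Definition Amx (R : comNzRingType) (n : nat) (d h : R) : 'M[R]_n :=
  d *: Pmx R n + h *: Qmx R n.

Definition Bmx (R : comNzRingType) (n : nat) (e f g : R) : 'M[R]_n :=
  f *: 1%:M + e *: Pmx R n + g *: Qmx R n.

Definition Cmx (R : comNzRingType) (n : nat) (a b c : R) : 'M[R]_n :=
  b *: 1%:M + c *: Pmx R n + a *: Qmx R n.

Lemma sum_const_ord (m n : nat) : (\sum_(i < m) n = m * n)%N.
Proof. by rewrite sum_nat_const card_ord. Qed.

Definition tridiag_block (R : comNzRingType) (m n : nat) (A1 B1 C1 D1 : 'M[R]_n) :
    'M[R]_(m * n) :=
  castmx (sum_const_ord m n, sum_const_ord m n)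
    (\mxblock_(i < m, j < m)
       (if i == j then A1
        else if j == i.+1 :> nat then B1
        else if i == j.+1 :> nat then (if i.+1 == m then D1 else C1)
        else 0)).

(* Main.v *)
Require Import Defs.
From mathcomp Require Import all_boot all_order all_algebra.
From mathcomp Require Import ring.

Set Implicit Arguments.
Unset Strict Implicit.
Unset Printing Implicit Defensive.

Import GRing.Theory.
Local Open Scope ring_scope.

(** The automaton acts on a configuration one row at a time, so the idea is to
read every row of a product with the block matrix as a local rule on rows.

Extend a configuration [X] by 0 to all 1-based positions ([nullext]).  On the
row [k] of this extension, [I], [P] and [Q] read the cell itself, its right
neighbour and its left neighbour, and the null condition on the left and right
costs nothing since the rows of [P] and [Q] are simply cut off at the edges.
Reflecting on the right means that the last cell also sees the cell of column
[n - 1] in place of its right neighbour, which is what adding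
[v epsilon_(n,n-1)] to [v P] does ([band_padrow]).

In the vertical direction the block tridiagonal shape gives, in block row [i],
the action of [A1], [B1] and [C1] on the rows [i], [i + 1] and [i - 1] of the
extension, the rows 0 and [m + 1] contributing nothing ([sum_tridiag]).  This
is the rule itself, except in the last block row: there the reflected row
[m + 1] is a copy of row [m - 1], so the terms of [B1] move to the block column
[m - 1] and [C1] becomes [B1 + C1].  The copy is exact but for the corner
[(m + 1, 0)], which carries the value at [(m - 1, 2)] where the horizontal
extension of row [m - 1] has 0 ([phi_ext_below]); its only reader is the cell
[(m, 1)], with the coefficient [g], whence the last term [g epsilon_(1,2)] of
[D1].  So the block matrix is a rule matrix ([tridiag_is_phi_rule]).

Rule matrices are unique because configuration vectors exhaust the column
space ([config_vec_inj_mulmx]).  What remains is bookkeeping: the row by row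
enumeration of the entries of a configuration agrees with the enumeration of
the rows of a block matrix, both sending [(i, j)] to [i n + j]
([castmx_mxblock_index]). *)

Lemma index_allpairs_pair (S T : eqType) (s : seq S) (t : seq T) x y :
  x \in s -> y \in t ->
  index (x, y) [seq (u, v) | u <- s, v <- t] =
    (index x s * size t + index y t)%N.
Proof.
move=> + yt; elim: s => //= z s IHs.
rewrite in_cons index_cat size_map [z == x]eq_sym.
have [-> _ | neq_xz /= xs] := eqVneq x z.
  by rewrite map_f // index_map // => u v [].
rewrite ifN ?IHs //; first by rewrite mulSn addnA.
by apply: contra neq_xz => /mapP[v _ [->]].
Qed.

(** [mxvec] is defined through the abstract enumeration of pairs; this makes its
numbering of the entries explicit. *)
Lemma val_mxvec_index (m n : nat) (i : 'I_m) (j : 'I_n) :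
  mxvec_index i j = (i * n + j)%N :> nat.
Proof.
rewrite /mxvec_index /= -[LHS](index_uniq (i, j) _ (enum_uniq {: 'I_m * 'I_n})).
  rewrite nth_enum_rank enumT unlock /= index_allpairs_pair ?mem_enum //.
  by rewrite !index_enum_ord size_enum_ord.
by rewrite -cardE.
Qed.

(** Both numberings being lexicographic, the cast between the two index types
identifies position [j] of block [i] with the entry [(i, j)] of a
configuration. *)
Lemma castmx_mxblock_index (R : Type) (m n : nat) (B : 'I_m -> 'I_m -> 'M[R]_n)
    (i i' : 'I_m) (j j' : 'I_n) :
  castmx (sum_const_ord m n, sum_const_ord m n) (\mxblock_(k, l) B k l)
    (mxvec_index i j) (mxvec_index i' j') = B i i' j j'.
Proof.
have RankE (k : 'I_m) (l : 'I_n) :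
    cast_ord (esym (sum_const_ord m n)) (mxvec_index k l)
    = @tagnat.Rank m (fun=> n) k l.
  apply: ord_inj; rewrite tagnat.RankEsum [LHS]val_mxvec_index.
  rewrite (big_ord_narrow (ltnW (ltn_ord k))) /=.
  by rewrite sum_nat_const card_ord.
rewrite castmxE !RankE.
have := mxblockK B i i' => /matrixP/(_ j j'); by rewrite mxE.
Qed.

Lemma mulmx_config_vec (R : comNzRingType) (m n : nat) (T : 'M[R]_(m * n))
    (X : 'M[R]_(m, n)) i j :
  (T *m config_vec X) (mxvec_index i j) 0 =
  \sum_i' \sum_j' T (mxvec_index i j) (mxvec_index i' j') * X i' j'.
Proof.
rewrite mxE (reindex _ (curry_mxvec_bij m n)) /= [RHS]pair_bigA.
by apply: eq_bigr => -[i' j'] _; rewrite !mxE mxvecE.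
Qed.

Definition nullext (R : comNzRingType) (m n : nat) (X : 'M[R]_(m, n)) (k l : nat) : R :=
  if (k == 0%N) || (l == 0%N) then 0 else cell X k l.

(** Row [k] for every natural number [k], so that the neighbouring rows of the
first and last row of the grid exist, as zero columns. *)
Definition padrow (R : comNzRingType) (m n : nat) (X : 'M[R]_(m, n)) (k : nat) :
    'cV[R]_n :=
  \col_j nullext X k j.+1.

Lemma cell_ord (R : comNzRingType) (m n : nat) (X : 'M[R]_(m, n)) (i : 'I_m) (j : 'I_n) :
  cell X i.+1 j.+1 = X i j.
Proof. by rewrite /cell /= !valK. Qed.

Lemma nullext_row_oob (R : comNzRingType) (m n : nat) (X : 'M[R]_(m, n)) k l :
  (m < k)%N -> nullext X k l = 0.
Proof.
case: k => // k; rewrite ltnS => lemk; rewrite /nullext /cell /=.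
have -> : (insub k : option 'I_m) = None by apply: insubN; rewrite -leqNgt.
by case: ifP.
Qed.

Lemma nullext_col_oob (R : comNzRingType) (m n : nat) (X : 'M[R]_(m, n)) k l :
  (n < l)%N -> nullext X k l = 0.
Proof.
case: l => // l; rewrite ltnS => lenl; rewrite /nullext /cell /= orbF.
have -> : (insub l : option 'I_n) = None by apply: insubN; rewrite -leqNgt.
by case: ifP => // _; case: (insub k.-1 : option 'I_m).
Qed.

(** Selecting a 1-based index: the vanishing of [F] outside the range makes the
boundary cases of the shifts below disappear. *)
Lemma sum_delta_succ (V : nmodType) (n l : nat) (F : nat -> V) :
  F 0%N = 0 -> ((n < l)%N -> F l = 0) ->
  \sum_(k < n) F k.+1 *+ (k.+1 == l) = F l.
Proof.
move=> F0 Foob; case: l Foob => [_|l Foob]; first by rewrite F0 big1.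
case: (ltnP l n) => [ltln | lenl].
  rewrite (bigD1 (Ordinal ltln)) //= eqxx big1 ?addr0 // => k.
  by rewrite eqSS -val_eqE => /negPf/= ->.
rewrite Foob // big1 // => k _; rewrite eqSS ltn_eqF //.
exact: leq_trans lenl.
Qed.

Lemma sum_nullext_row (R : comNzRingType) (m n : nat) (X : 'M[R]_(m, n)) (k l : nat) :
  \sum_(j < n) (j.+1 == l)%:R * nullext X k j.+1 = nullext X k l.
Proof.
under eq_bigr do rewrite mulr_natl.
apply: sum_delta_succ; first by rewrite /nullext orbT.
exact: nullext_col_oob.
Qed.

(** The boundary condition in the horizontal direction alone. *)
Definition rowext (R : comNzRingType) (m n : nat) (X : 'M[R]_(m, n)) (k l : nat) : R :=
  if l == n.+1 then nullext X k n.-1 else nullext X k l.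

Lemma mulmxDl_entry (R : pzRingType) (q n r : nat) (M N : 'M[R]_(q, n))
    (V : 'M[R]_(n, r)) i j :
  ((M + N) *m V) i j = (M *m V) i j + (N *m V) i j.
Proof. by rewrite mulmxDl [LHS]mxE. Qed.

Lemma scalemxAl_entry (R : pzRingType) (q n r : nat) (z : R) (M : 'M[R]_(q, n))
    (V : 'M[R]_(n, r)) i j :
  ((z *: M) *m V) i j = z * (M *m V) i j.
Proof. by rewrite -scalemxAl [LHS]mxE. Qed.

Lemma scalar_padrow (R : comNzRingType) (m n : nat) (X : 'M[R]_(m, n))
    (k : nat) (j : 'I_n) :
  (1%:M *m padrow X k) j 0 = nullext X k j.+1.
Proof. by rewrite mul1mx mxE. Qed.

Lemma Pmx_padrow (R : comNzRingType) (m n : nat) (X : 'M[R]_(m, n))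
    (k : nat) (j : 'I_n) :
  (Pmx R n *m padrow X k) j 0 = nullext X k j.+2.
Proof.
by rewrite -sum_nullext_row mxE; apply: eq_bigr => j' _; rewrite !mxE.
Qed.

Lemma Qmx_padrow (R : comNzRingType) (m n : nat) (X : 'M[R]_(m, n))
    (k : nat) (j : 'I_n) :
  (Qmx R n *m padrow X k) j 0 = nullext X k j.
Proof.
rewrite -sum_nullext_row mxE.
by apply: eq_bigr => j' _; rewrite !mxE [in RHS]eq_sym.
Qed.

Lemma epsmx_padrow (R : comNzRingType) (m n : nat) (X : 'M[R]_(m, n))
    (k : nat) (j : 'I_n) (r l : nat) :
  (epsmx R n r l *m padrow X k) j 0 =
    if j.+1 == r then nullext X k l else 0.
Proof.
rewrite -sum_nullext_row mxE; case: ifP => eq_jr; last first.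
  by rewrite big1 // => j' _; rewrite !mxE eq_jr mul0r.
by apply: eq_bigr => j' _; rewrite !mxE eq_jr.
Qed.

(** Reusing the coefficient [v] of [P] on [epsilon_(n,n-1)] turns the null
condition on the right into reflection: in the last column, where the
superdiagonal is cut off, it supplies the mirror image of the missing
neighbour. *)
Lemma band_padrow (R : comNzRingType) (m n : nat) (X : 'M[R]_(m, n))
    (k : nat) (j : 'I_n) (u v w : R) :
  ((u *: 1%:M + v *: Pmx R n + w *: Qmx R n + v *: epsmx R n n n.-1)
     *m padrow X k) j 0 =
  w * rowext X k j + u * rowext X k j.+1 + v * rowext X k j.+2.
Proof.
rewrite !mulmxDl_entry !scalemxAl_entry scalar_padrow Pmx_padrow Qmx_padrow epsmx_padrow.
rewrite /rowext !eqSS (ltn_eqF (ltn_ord j)) (ltn_eqF (leqW (ltn_ord j))).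
case: eqP => [eq_jn | _]; last by ring.
by rewrite (@nullext_col_oob _ _ _ _ _ j.+2) ?eq_jn //; ring.
Qed.

Lemma phi_ext_inside (R : comNzRingType) (m n : nat) (X : 'M[R]_(m, n)) (k l : nat) :
  (1 < n)%N -> (k <= m)%N -> phi_ext X k l = rowext X k l.
Proof.
case: n X => [|[|n]] X // _ lekm; rewrite /phi_ext /rowext /nullext lekm.
by case: k {lekm} => [|k]; case: l => [|l] //=; case: ifP.
Qed.

(** The row below the grid mirrors row [m - 1] with its horizontal extension,
except at its left corner, where the vertical and horizontal conditions
disagree. *)
Lemma phi_ext_below (R : comNzRingType) (m n : nat) (X : 'M[R]_(m, n)) (l : nat) :
  (1 < m)%N -> (1 < n)%N ->
  phi_ext X m.+1 l =
    rowext X m.-1 l + if l == 0%N then nullext X m.-1 2 else 0.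
Proof.
case: m n X => [|[|m]] // [|[|n]] // X _ _.
rewrite /phi_ext /rowext /nullext ltnn /=.
by case: l => [|l] /=; rewrite ?add0r // ?addr0; case: ifP.
Qed.

(** Padding with zero rows lets all block rows be treated alike, including the
first and the last, where a neighbouring block is missing. *)
Lemma sum_tridiag (R : comNzRingType) (m n : nat) (A B C : 'M[R]_n)
   (X : 'M[R]_(m, n)) (i : 'I_m) :
  \sum_(k < m) (if i == k then A else if k == i.+1 :> nat then B
               else if i == k.+1 :> nat then C else 0) *m padrow X k.+1
  = A *m padrow X i.+1 + B *m padrow X i.+2 + C *m padrow X i.
Proof.
pose F (M : 'M[R]_n) k := M *m padrow X k.
have F0 M : F M 0%N = 0.
  by apply/matrixP=> j j'; rewrite /F !mxE big1 // => l _; rewrite !mxE mulr0.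
have Foob M k : (m < k)%N -> F M k = 0.
  move=> ltmk; apply/matrixP=> j j'; rewrite /F !mxE big1 // => l _.
  by rewrite !mxE nullext_row_oob // mulr0.
rewrite -/(F A _) -/(F B _) -/(F C _).
rewrite -(sum_delta_succ (F0 A) (@Foob A _)) -(sum_delta_succ (F0 B) (@Foob B _)).
rewrite -(sum_delta_succ (F0 C) (@Foob C _)) -!big_split; apply: eq_bigr => k _ /=.
rewrite -val_eqE /= !eqSS [k.+1 == i :> nat]eq_sym [k == i :> nat]eq_sym.
case: eqVneq => [->|_]; first by rewrite !ltn_eqF // !addr0.
case: eqVneq => [->|_]; first by rewrite ltn_eqF // add0r addr0.
by rewrite !add0r; case: eqP => // _; rewrite mul0mx.
Qed.

(** Unit vectors are configuration vectors, and they pick out the columns. *)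
Lemma config_vec_inj_mulmx (R : comNzRingType) (m n : nat) (T T' : 'M[R]_(m * n)) :
  (forall X : 'M[R]_(m, n), T *m config_vec X = T' *m config_vec X) -> T = T'.
Proof.
move=> eqTT'; apply/trmx_inj/row_matrixP => k.
have := eqTT' (vec_mx (delta_mx 0 k)).
rewrite /config_vec vec_mxK => /(congr1 trmx).
by rewrite !trmx_mul !trmxK -!rowE.
Qed.

Lemma tridiag_is_phi_rule (R : comNzRingType) (m n : nat) (a b c d e f g h : R) :
  (1 < m)%N -> (1 < n)%N ->
  is_phi_rule_matrix a b c d e f g h
    (tridiag_block m
       (Amx n d h + d *: epsmx R n n n.-1)
       (Bmx n e f g + e *: epsmx R n n n.-1)
       (Cmx n a b c + c *: epsmx R n n n.-1)
       (Bmx n e f g + Cmx n a b c + (c + e) *: epsmx R n n n.-1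
          + g *: epsmx R n 1 2)).
Proof.
move=> m_gt1 n_gt1 X; apply/colP => s; case/mxvec_indexP: s => i j.
rewrite mulmx_config_vec.
set A1 := (X in tridiag_block m X); set B1 := (X in tridiag_block m _ X).
set C1 := (X in tridiag_block m _ _ X); set D1 := (X in tridiag_block m _ _ _ X).
transitivity ((A1 *m padrow X i.+1 + B1 *m padrow X i.+2
               + (if i.+1 == m then D1 else C1) *m padrow X i) j 0); last first.
  rewrite -sum_tridiag summxE; apply: eq_bigr => i' _.
  rewrite mxE; apply: eq_bigr => j' _.
  by rewrite castmx_mxblock_index !mxE /nullext cell_ord.
rewrite 2!mxE mxvecE mxE.
have actA : (A1 *m padrow X i.+1) j 0
    = h * rowext X i.+1 j + d * rowext X i.+1 j.+2.
  (* [A1] has no identity part: the centre cell is not its own neighbour. *)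
  have := band_padrow X i.+1 j 0 d h.
  by rewrite scale0r add0r mul0r addr0.
have actB k : (B1 *m padrow X k) j 0
    = g * rowext X k j + f * rowext X k j.+1 + e * rowext X k j.+2.
  exact: band_padrow.
have actC k : (C1 *m padrow X k) j 0
    = a * rowext X k j + b * rowext X k j.+1 + c * rowext X k j.+2.
  exact: band_padrow.
have actD k : (D1 *m padrow X k) j 0
    = (B1 *m padrow X k) j 0 + (C1 *m padrow X k) j 0
      + g * if j == 0%N :> nat then nullext X k 2 else 0.
  (* The corner term is the action of [epsilon_(1,2)], as [j] is 0-based. *)
  rewrite -[if _ then _ else _](epsmx_padrow X k j 1).
  have -> : D1 = B1 + C1 + g *: epsmx R n 1 2.
    by rewrite /D1 scalerDl [c *: _ + _]addrC addrACA.
  by rewrite mulmxDl_entry (mulmxDl_entry B1) scalemxAl_entry.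
have rowext_oob l : rowext X m.+1 l = 0.
  by rewrite /rowext !nullext_row_oob // if_same.
rewrite [X in _ = X + _]mxE actA actB.
have le_im := ltnW (ltn_ord i).
rewrite !(phi_ext_inside _ _ n_gt1 le_im) !(phi_ext_inside _ _ n_gt1 (ltn_ord i)).
have [eq_im | neq_im] := eqVneq i.+1 m.
  rewrite actD actB actC eq_im !(phi_ext_below _ _ m_gt1 n_gt1) !rowext_oob.
  (* The mirror row [m - 1] is, in 1-based numbering, the row [i] above. *)
  have -> : m.-1 = i by rewrite -(congr1 predn eq_im).
  by rewrite /=; ring.
have lt_im : (i.+2 <= m)%N by rewrite ltn_neqAle neq_im ltn_ord.
by rewrite actC !(phi_ext_inside _ _ n_gt1 lt_im); ring.
Qed.

Theorem theorem3p1 (p m n : nat) (a b c d e f g h : 'F_p)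
    (p_prime : prime p) (m_ge2 : (2 <= m)%N) (n_ge2 : (2 <= n)%N)
    (T : 'M['F_p]_(m * n)) :
  let A := Amx n d h in
  let B := Bmx n e f g in
  let C := Cmx n a b c in
  let A1 := A + d *: epsmx 'F_p n n n.-1 in
  let B1 := B + e *: epsmx 'F_p n n n.-1 in
  let C1 := C + c *: epsmx 'F_p n n n.-1 in
  let D1 := B + C + (c + e) *: epsmx 'F_p n n n.-1 + g *: epsmx 'F_p n 1 2 in
  is_phi_rule_matrix a b c d e f g h T <-> T = tridiag_block m A1 B1 C1 D1.
Proof.
move=> A B C A1 B1 C1 D1.
have TR := tridiag_is_phi_rule a b c d e f g h m_ge2 n_ge2.
split=> [ruleT | -> //].
by apply: config_vec_inj_mulmx => X; rewrite -ruleT -TR.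
Qed.
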